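(* Let $U$ be a topological group, $\mathcal{O}\le U$ an open subgroup, $\varphi\colon\mathcal{O}\hookrightarrow U$ a continuous open monomorphism, and let $\langle X\mid R\rangle$ be a presentation with $X$ finite that can be generalised over $\varphi$. Put $G:=F(X)/\langle\langle R\rangle\rangle$, endowed with the discrete topology. Let $\langle\langle U\rangle\rangle_{G_\varphi}$ be the normal closure of $U$ in $G_\varphi$, $i$ the inclusion map, and $p\colon G_\varphi\to G$ the epimorphism induced by the morphism $\tilde p\colon\mathcal{H}_X(\varphi)\to F(X)$ with $\tilde p(u)=1$ and $\tilde p(x)=x$ for all $u\in U$, $x\in X$. Then the sequence of topological groups $$1\to\langle\langle U\rangle\rangle_{G_\varphi}\xrightarrow{\,i\,}G_\varphi\xrightarrow{\,p\,}G\to1$$ is split exact. In particular, there is a topological isomorphism $G_\varphi\cong\langle\langle U\rangle\rangle_{G_\varphi}\rtimes_\Phi G$, where $\Phi\colon G\to\mathrm{Aut}(\langle\langle U\rangle\rangle_{G_\varphi})$ describes the $G$-action on $\langle\langle U\rangle\rangle_{G_\varphi}$ by conjugation, and the semidirect product carries the product topology ($\langle\langle U\rangle\rangle_{G_\varphi}$ with the subspace topology and $G$ discrete).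
   Context: All topological groups are Hausdorff. A continuous open monomorphism is an injective group homomorphism that is continuous and open. For a finite set $X$, $\mathcal{H}_X(\varphi)=(U*F(X))/\langle\langle t\omega t^{-1}\varphi(\omega)^{-1}\mid t\in X,\omega\in\mathcal{O}\rangle\rangle$ (with $\mathcal{H}_\varnothing(\varphi)=U$), endowed with the unique group topology making the canonical embedding $U\hookrightarrow\mathcal{H}_X(\varphi)$ continuous and open. For a presentation $\langle X\mid R\rangle$ with $X$ finite, $G_\varphi:=\mathcal{H}_X(\varphi)/\langle\langle R\rangle\rangle$, with the quotient topology. The presentation can be generalised over $\varphi$ if the composite $U\hookrightarrow\mathcal{H}_X(\varphi)\twoheadrightarrow G_\varphi$ is injective; then $U$ is identified with its image, an open subgroup of $G_\varphi$. *)

(* Defs.v *)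
From HB Require Import structures.
From mathcomp Require Import all_boot all_classical.
From mathcomp Require Import topology.

Set Implicit Arguments.
Unset Strict Implicit.
Unset Printing Implicit Defensive.

Local Open Scope classical_set_scope.
Local Open Scope quotient_scope.
Local Open Scope group_scope.

Reserved Notation "{ 'ghom' G -> H }"
  (at level 0, G at level 98, H at level 99, format "{ 'ghom'  G  ->  H }").
Notation "{ 'ghom' G -> H }" :=
  (UMagmaMorphism.type G%type H%type) : type_scope.

(** Hausdorffness is kept separate, as [hausdorff_space G]. *)
HB.mixin Record isTopologicalGroup G & Group G & Topological G := {
  mulg_continuous : continuous (fun xy : G * G => xy.1 * xy.2) ;
  invg_continuous : continuous (fun x : G => x^-1)
}.

#[short(type="topologicalGroupType")]
HB.structure Definition TopologicalGroup :=
  {G of Group G & Topological G & isTopologicalGroup G}.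

Section TopologicalGroupTheory.
Context (G : topologicalGroupType).
Implicit Types (g x : G) (A : set G).

Lemma cvg_mulg (T : Type) (F : set_system T) (FF : Filter F) (f h : T -> G) a b :
  f @ F --> a -> h @ F --> b -> (fun t => f t * h t) @ F --> a * b.
Proof.
move=> fa hb; apply: (@cvg_comp _ _ _ (fun t => (f t, h t))
  (fun xy : G * G => xy.1 * xy.2) F (nbhs (a, b))).
  exact: cvg_pair.
exact: (@mulg_continuous G (a, b)).
Qed.

Lemma mulgl_continuous g : continuous (fun x => g * x).
Proof. by move=> x; apply: cvg_mulg; [exact: cvg_cst|exact: cvg_id]. Qed.

Lemma mulgr_continuous g : continuous (fun x => x * g).
Proof. by move=> x; apply: cvg_mulg; [exact: cvg_id|exact: cvg_cst]. Qed.

Lemma nbhs_mulgl g x A : nbhs (g * x) A -> nbhs x [set y | A (g * y)].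
Proof. by move=> /mulgl_continuous. Qed.

End TopologicalGroupTheory.

HB.instance Definition _ (G : groupType) :=
  Group.copy (discrete_topology G) G.

Section DiscreteGroup.
Context (G : groupType).
Local Notation D := (discrete_topology G).

Lemma discrete_mulg_continuous : continuous (fun xy : D * D => xy.1 * xy.2).
Proof.
move=> [x y] A /nbhs_singleton/= Axy.
exists ([set x], [set y]); first by split; exact: discrete_set1.
by move=> [x' y'] /= [-> ->].
Qed.

Lemma discrete_invg_continuous : continuous (fun x : D => x^-1).
Proof.
move=> x A /nbhs_singleton/= Ax.
by rewrite nbhs_principalE; apply/principal_filterP.
Qed.

HB.instance Definition _ :=
  isTopologicalGroup.Build D discrete_mulg_continuous discrete_invg_continuous.
End DiscreteGroup.

Record subgroup (G : groupType) := Subgroup {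
  subgroup_set :> set G ;
  subgroup1 : subgroup_set 1 ;
  subgroupM : forall x y, subgroup_set x -> subgroup_set y ->
                subgroup_set (x * y) ;
  subgroupV : forall x, subgroup_set x -> subgroup_set x^-1
}.

Record normal_subgroup (G : groupType) := NormalSubgroup {
  normal_subgroup_subgroup :> subgroup G ;
  normal_subgroupJ : forall x y,
    subgroup_set normal_subgroup_subgroup x ->
    subgroup_set normal_subgroup_subgroup (x ^ y)
}.

Section NormalClosure.
Context (G : groupType) (A : set G).

Definition normal_closure_set : set G :=
  [set x | forall N : normal_subgroup G, A `<=` N -> subgroup_set N x].

Fact normal_closure1 : normal_closure_set 1.
Proof. by move=> N _; exact: subgroup1. Qed.
Fact normal_closureM x y : normal_closure_set x -> normal_closure_set y ->
  normal_closure_set (x * y).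
Proof. by move=> Nx Ny N AN; apply: subgroupM; [exact: Nx|exact: Ny]. Qed.
Fact normal_closureV x : normal_closure_set x -> normal_closure_set x^-1.
Proof. by move=> Nx N AN; apply: subgroupV; exact: Nx. Qed.
Fact normal_closureJ x y : normal_closure_set x -> normal_closure_set (x ^ y).
Proof. by move=> Nx N AN; apply: normal_subgroupJ; exact: Nx. Qed.

Definition normal_closure : normal_subgroup G :=
  @NormalSubgroup G
    (Subgroup normal_closure1 normal_closureM normal_closureV)
    normal_closureJ.

Lemma sub_normal_closure : A `<=` normal_closure.
Proof. by move=> x Ax N; apply. Qed.
End NormalClosure.

Definition subgroup_type (G : groupType) (S : subgroup G) : Type :=
  set_type S.

Section SubgroupType.
Context (G : groupType) (S : subgroup G).

HB.instance Definition _ := SubChoice.copy (subgroup_type S) (set_type S).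

Fact subgroup_group_closed : group_closed (fun x => x \in (S : set G)).
Proof.
split => [|x y]; first by rewrite unfold_in; apply/mem_set; exact: subgroup1.
by rewrite !unfold_in => /set_mem Sx /set_mem Sy; apply/mem_set/subgroupM => //;
  exact: subgroupV.
Qed.

HB.instance Definition _ :=
  SubChoice_isSubGroup.Build G (fun x => x \in (S : set G)) (subgroup_type S)
    subgroup_group_closed.
End SubgroupType.

Section SubgroupTopology.
Context (G : topologicalGroupType) (S : subgroup G).
Local Notation T := (subgroup_type S).

HB.instance Definition _ := Topological.copy T (set_type S).

Lemma subgroup_val_continuous : continuous (\val : T -> G).
Proof. exact: (@initial_continuous T G \val). Qed.

Lemma subgroup_continuousP (Z : topologicalType) (f : Z -> T) :
  continuous (\val \o f : Z -> G) -> continuous f.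
Proof.
move=> /continuousP fc; apply/continuousP => _ [B oB <-].
exact: (fc B oB).
Qed.

Fact subgroup_mulg_continuous : continuous (fun xy : T * T => xy.1 * xy.2).
Proof.
apply: subgroup_continuousP => -[x y].
apply: (@cvg_mulg G _ _ _ (\val \o fst) (\val \o snd)).
- by apply: continuous_comp; [exact: cvg_fst|exact: subgroup_val_continuous].
- by apply: continuous_comp; [exact: cvg_snd|exact: subgroup_val_continuous].
Qed.

Fact subgroup_invg_continuous : continuous (fun x : T => x^-1).
Proof.
apply: subgroup_continuousP => x.
apply: (@continuous_comp _ _ _ (\val : T -> G) (fun x : G => x^-1)).
  exact: subgroup_val_continuous.
exact: invg_continuous.
Qed.

HB.instance Definition _ := isTopologicalGroup.Build T
  subgroup_mulg_continuous subgroup_invg_continuous.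
End SubgroupTopology.

Section QuotientGroup.
Context (G : groupType) (N : normal_subgroup G).

Definition eqcoset : rel G := [rel x y | `[< subgroup_set N (x^-1 * y) >]].

Fact eqcoset_is_equiv : equiv_class_of eqcoset.
Proof.
split=> [x|x y|y x z] /=.
- by apply/asboolP; rewrite mulVg; exact: subgroup1.
- by apply/asboolP/asboolP => /(@subgroupV _ N); rewrite invgM invgK.
- move=> /asboolP Nxy /asboolP Nyz; apply/asboolP.
  by rewrite -(mulgK y x^-1) -mulgA; exact: subgroupM.
Qed.
Canonical eqcoset_equiv := EquivRelPack eqcoset_is_equiv.

Definition quotg : Type := {eq_quot eqcoset_equiv}.
HB.instance Definition _ := Choice.on quotg.
HB.instance Definition _ := EqQuotient.on quotg.

Lemma quotgP x y : \pi_quotg x = \pi_quotg y <-> subgroup_set N (x^-1 * y).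
Proof.
have h := @eqquotP _ eqcoset_equiv quotg x y.
by split=> [/h/asboolP|/asboolP nxy]; last exact/h.
Qed.

Definition quotg_one : quotg := \pi_quotg 1.
Definition quotg_mul (x y : quotg) : quotg := \pi_quotg (repr x * repr y).
Definition quotg_inv (x : quotg) : quotg := \pi_quotg (repr x)^-1.

Lemma quotg_repr x : exists2 n, subgroup_set N n & repr (\pi_quotg x) = x * n.
Proof.
exists (x^-1 * repr (\pi_quotg x)); last by rewrite mulVKg.
by apply/quotgP; rewrite reprK.
Qed.

Lemma quotg_piM x y : quotg_mul (\pi_quotg x) (\pi_quotg y) = \pi_quotg (x * y).
Proof.
have [n Nn xE] := quotg_repr x; have [m Nm yE] := quotg_repr y.
rewrite /quotg_mul xE yE; apply/esym/quotgP.
have -> : (x * y)^-1 * (x * n * (y * m)) = n ^ y * m.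
  by rewrite invgM /conjg -!mulgA mulKg.
by apply: subgroupM => //; exact: normal_subgroupJ.
Qed.

Lemma quotg_piV x : quotg_inv (\pi_quotg x) = \pi_quotg x^-1.
Proof.
have [n Nn xE] := quotg_repr x; rewrite /quotg_inv xE; apply/esym/quotgP.
have -> : x^-1^-1 * (x * n)^-1 = n^-1 ^ x^-1.
  by rewrite invgM /conjg invgK.
exact/normal_subgroupJ/subgroupV.
Qed.

Fact quotg_mulA : associative quotg_mul.
Proof.
move=> x y z; rewrite -(reprK x) -(reprK y) -(reprK z).
move: (repr x) (repr y) (repr z) => a b c.
by rewrite (quotg_piM a b) (quotg_piM b c) (quotg_piM a) (quotg_piM _ c) mulgA.
Qed.
Fact quotg_mul1 : left_id quotg_one quotg_mul.
Proof. by move=> x; rewrite -(reprK x) quotg_piM mul1g. Qed.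
Fact quotg_1mul : right_id quotg_one quotg_mul.
Proof. by move=> x; rewrite -(reprK x) quotg_piM mulg1. Qed.
Fact quotg_mulV : left_inverse quotg_one quotg_inv quotg_mul.
Proof. by move=> x; rewrite -(reprK x) quotg_piV quotg_piM mulVg. Qed.
Fact quotg_Vmul : right_inverse quotg_one quotg_inv quotg_mul.
Proof. by move=> x; rewrite -(reprK x) quotg_piV quotg_piM mulgV. Qed.

HB.instance Definition _ := isGroup.Build quotg
  quotg_mulA quotg_mul1 quotg_1mul quotg_mulV quotg_Vmul.

Definition quotg_pi : G -> quotg := \pi_quotg.

Fact quotg_pi_morphism : {morph quotg_pi : x y / x / y}.
Proof. by move=> x y; rewrite /quotg_pi -quotg_piM -quotg_piV. Qed.
HB.instance Definition _ :=
  isGroupMorphism.Build G quotg quotg_pi quotg_pi_morphism.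

Lemma quotg_pi_eq1 x : quotg_pi x = 1 <-> subgroup_set N x.
Proof.
have -> : (1 : quotg) = quotg_pi 1 by [].
split=> [/esym/quotgP|Nx]; first by rewrite invg1 mul1g.
by apply/esym/quotgP; rewrite invg1 mul1g.
Qed.

Lemma quotg_pi_surj (q : quotg) : exists x, q = quotg_pi x.
Proof. by exists (repr q); rewrite /quotg_pi reprK. Qed.

(** The factorisation of [f] through [quotg_pi]; meaningful when [f] kills [N],
    see [quotg_liftE]. *)
Definition quotg_lift (H : Type) (f : G -> H) (q : quotg) : H := f (repr q).

Section Lift.
Context (H : groupType) (f : {ghom G -> H}).
Hypothesis fN : forall x, subgroup_set N x -> f x = 1.

Lemma quotg_liftE x : quotg_lift f (quotg_pi x) = f x.
Proof.
by have [n /fN fn1 xE] := quotg_repr x; rewrite /quotg_lift xE gmulfM fn1 mulg1.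
Qed.

Lemma quotg_lift_morphism : {morph quotg_lift f : x y / x / y}.
Proof.
move=> x y; have [[a ->] [b ->]] := (quotg_pi_surj x, quotg_pi_surj y).
by rewrite -gmulfF !quotg_liftE gmulfF.
Qed.
End Lift.
End QuotientGroup.

Lemma normal_closure_ker (G H : groupType) (A : set G) (f : {ghom G -> H}) :
  (forall x, A x -> f x = 1) ->
  forall x, subgroup_set (normal_closure A) x -> f x = 1.
Proof.
move=> fA.
have k1 : [set x | f x = 1] 1 by exact: gmulf1.
have kM x y : [set x | f x = 1] x -> [set x | f x = 1] y ->
    [set x | f x = 1] (x * y) by move=> /= fx fy; rewrite gmulfM fx fy mulg1.
have kV x : [set x | f x = 1] x -> [set x | f x = 1] x^-1.
  by move=> /= fx; rewrite gmulfV fx invg1.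
have kJ x y : subgroup_set (Subgroup k1 kM kV) x ->
    subgroup_set (Subgroup k1 kM kV) (x ^ y).
  by move=> /= fx; rewrite gmulfJ fx conj1g.
by move=> x /(_ (NormalSubgroup kJ)); apply.
Qed.

Section QuotientTopology.
Context (G : topologicalGroupType) (N : normal_subgroup G).
Local Notation Q := (quotg N).

Definition quotg_open : set (set Q) :=
  [set V | open (quotg_pi N @^-1` V)].

Fact quotg_openT : quotg_open setT.
Proof. by rewrite /quotg_open /= preimage_setT; exact: openT. Qed.
Fact quotg_openI : setI_closed quotg_open.
Proof. by move=> V W oV oW; exact: openI. Qed.
Fact quotg_open_bigU (I : Type) (F : I -> set Q) :
  (forall i, quotg_open (F i)) -> quotg_open (\bigcup_i F i).
Proof. by move=> oF; apply: bigcup_open => i _; exact: oF. Qed.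

HB.instance Definition _ := isOpenTopological.Build Q
  quotg_openT quotg_openI quotg_open_bigU.

Lemma quotg_pi_continuous : continuous (quotg_pi N).
Proof. exact/continuousP. Qed.

Lemma quotg_pi_nbhs (x : G) (A : set G) :
  nbhs x A -> nbhs (quotg_pi N x) (quotg_pi N @` A).
Proof.
rewrite nbhsE => -[B [oB Bx] BA].
rewrite nbhsE; exists (quotg_pi N @` B); last exact: image_subset.
split; last by exists x.
rewrite /open /= /quotg_open /= openE => y /= [b Bb /esym/quotgP Nyb].
set n := y^-1 * b in Nyb.
have By : nbhs (y * n) B by rewrite /n mulVKg; apply: open_nbhs_nbhs.
have : nbhs y [set z | B (z * n)] := @mulgr_continuous G n y _ By.
apply: filterS => z /= Bz.
by exists (z * n) => //; rewrite gmulfM/= (quotg_pi_eq1 N n).2 ?mulg1.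
Qed.

Fact quotg_mulg_continuous : continuous (fun xy : Q * Q => xy.1 * xy.2).
Proof.
move=> [p q]; have [[x ->] [y ->]] := (quotg_pi_surj p, quotg_pi_surj q).
move=> A /=; rewrite -gmulfM => /quotg_pi_continuous.
move=> /(@mulg_continuous G (x, y)) [[B C] /= [Bx Cy] BC].
exists (quotg_pi N @` B, quotg_pi N @` C).
  by split => /=; exact: quotg_pi_nbhs.
move=> [_ _] /= [[b Bb <-] [c Cc <-]].
by have := BC (b, c); rewrite /= -gmulfM; apply.
Qed.

Fact quotg_invg_continuous : continuous (fun x : Q => x^-1).
Proof.
move=> p; have [x ->] := quotg_pi_surj p => A; rewrite -gmulfV.
move=> /quotg_pi_continuous /(@invg_continuous G x) xA.
have := quotg_pi_nbhs xA; apply: filterS => _ [y /= Ay <-].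
by rewrite /= -gmulfV.
Qed.

HB.instance Definition _ := isTopologicalGroup.Build Q
  quotg_mulg_continuous quotg_invg_continuous.
End QuotientTopology.

(** [presented P] is the group generated by the letters, in which [linv a] is
    inverse to [a] and in which [u = v] for each [rule u v]. *)
Record group_pres := GroupPres {
  letter :> choiceType ;
  linv : letter -> letter ;
  rule : seq letter -> seq letter -> Prop
}.

Section Presented.
Context (P : group_pres).

Inductive weq : seq P -> seq P -> Prop :=
| weq_refl u : weq u u
| weq_sym u v : weq u v -> weq v u
| weq_trans v u w : weq u v -> weq v w -> weq u w
| weq_cat u u' v v' : weq u u' -> weq v v' -> weq (u ++ v) (u' ++ v')
| weq_mulV a : weq [:: a; linv a] [::]
| weq_Vmul a : weq [:: linv a; a] [::]
| weq_rule u v : rule u v -> weq u v.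

Definition weqb : rel (seq P) := [rel u v | `[< weq u v >]].

Fact weqb_is_equiv : equiv_class_of weqb.
Proof.
split=> [u|u v|v u w] /=.
- exact/asboolP/weq_refl.
- by apply/asboolP/asboolP => /weq_sym.
- by move=> /asboolP uv /asboolP vw; exact/asboolP/(weq_trans uv).
Qed.
Canonical weqb_equiv := EquivRelPack weqb_is_equiv.

Definition presented : Type := {eq_quot weqb_equiv}.
HB.instance Definition _ := Choice.on presented.
HB.instance Definition _ := EqQuotient.on presented.

Lemma presentedP u v : \pi_presented u = \pi_presented v <-> weq u v.
Proof.
have h := @eqquotP _ weqb_equiv presented u v.
by split=> [/h/asboolP|/asboolP uv]; last exact/h.
Qed.

Definition winv (w : seq P) := rev (map (@linv P) w).

Definition presented_one : presented := \pi_presented [::].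
Definition presented_mul (x y : presented) : presented :=
  \pi_presented (repr x ++ repr y).
Definition presented_inv (x : presented) : presented := \pi_presented (winv (repr x)).

Lemma weq_repr u : weq (repr (\pi_presented u)) u.
Proof. by apply/presentedP; rewrite reprK. Qed.

Lemma presented_piM u v : presented_mul (\pi_presented u) (\pi_presented v) = \pi_presented (u ++ v).
Proof. by apply/presentedP/weq_cat; exact: weq_repr. Qed.

Lemma weq_winv w : weq (w ++ winv w) [::] /\ weq (winv w ++ w) [::].
Proof.
have mid u x y v : weq [:: x; y] [::] -> weq (u ++ v) [::] ->
    weq (u ++ [:: x; y] ++ v) [::].
  move=> xy uv; apply: weq_trans uv; apply: weq_cat; first exact: weq_refl.
  by rewrite -[X in weq _ X]cat0s; apply: weq_cat => //; exact: weq_refl.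
split.
  elim/last_ind: w => [|w a IH]; first exact: weq_refl.
  rewrite /winv map_rcons rev_rcons cat_rcons.
  by apply: (mid w a (linv a)) => //; exact: weq_mulV.
elim: w => [|a w IH]; first exact: weq_refl.
rewrite /winv /= rev_cons cat_rcons.
by apply: (mid (winv w) (linv a) a) => //; exact: weq_Vmul.
Qed.

Fact presented_mulA : associative presented_mul.
Proof.
move=> x y z; rewrite -(reprK x) -(reprK y) -(reprK z).
move: (repr x) (repr y) (repr z) => a b c.
by rewrite (presented_piM a b) (presented_piM b c) (presented_piM a)
  (presented_piM _ c) catA.
Qed.
Fact presented_mul1 : left_id presented_one presented_mul.
Proof. by move=> x; rewrite -(reprK x) presented_piM. Qed.
Fact presented_1mul : right_id presented_one presented_mul.
Proof. by move=> x; rewrite -(reprK x) presented_piM cats0. Qed.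
Fact presented_mulV : left_inverse presented_one presented_inv presented_mul.
Proof.
move=> x; rewrite -{2}(reprK x) presented_piM.
by apply/presentedP; case: (weq_winv (repr x)).
Qed.
Fact presented_Vmul : right_inverse presented_one presented_inv presented_mul.
Proof.
move=> x; rewrite -{1}(reprK x) presented_piM.
by apply/presentedP; case: (weq_winv (repr x)).
Qed.

HB.instance Definition _ := isGroup.Build presented
  presented_mulA presented_mul1 presented_1mul presented_mulV presented_Vmul.

Definition letterg (a : P) : presented := \pi_presented [:: a].

Lemma lettergV a : letterg (linv a) = (letterg a)^-1.
Proof.
apply/esym/mulg1_eq; rewrite /letterg -[_ * _]/(presented_mul _ _).
by rewrite presented_piM; apply/presentedP/weq_mulV.
Qed.

(** The homomorphism extending [f]; meaningful when [f] respects the relations,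
    see [presented_liftE]. *)
Definition presented_lift (H : groupType) (f : P -> H) (x : presented) : H :=
  \prod_(a <- repr x) f a.

Section Lift.
Context (H : groupType) (f : P -> H).
Hypothesis f_inv : forall a, f (linv a) = (f a)^-1.
Hypothesis f_rule : forall u v, rule u v ->
  \prod_(a <- u) f a = \prod_(a <- v) f a.

Lemma weq_prod u v : weq u v -> \prod_(a <- u) f a = \prod_(a <- v) f a.
Proof.
elim=> {u v} [//|u v _ ->//|v u w _ -> _ ->//|u u' v v' _ uu' _ vv'|a|a|//].
- by rewrite !big_cat /= uu' vv'.
- by rewrite !big_cons !big_nil mulg1 f_inv mulgV.
- by rewrite !big_cons !big_nil mulg1 f_inv mulVg.
Qed.

Lemma presented_lift_pi u :
  presented_lift f (\pi_presented u) = \prod_(a <- u) f a.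
Proof. exact/weq_prod/weq_repr. Qed.

Lemma presented_liftE a : presented_lift f (letterg a) = f a.
Proof. by rewrite presented_lift_pi big_seq1. Qed.

Lemma presented_lift_monoid_morphism : monoid_morphism (presented_lift f).
Proof.
split=> [|x y]; first by rewrite presented_lift_pi big_nil.
rewrite -(reprK x) -(reprK y) [\pi_presented _ * _]presented_piM !presented_lift_pi.
by rewrite big_cat.
Qed.
End Lift.

Lemma presented_ind (S : presented -> Prop) :
  S 1 -> (forall a x, S x -> S (letterg a * x)) -> forall x, S x.
Proof.
move=> S1 SM x; rewrite -(reprK x); elim: (repr x) => [//|a w IH].
by have := SM a _ IH; rewrite [_ * _]presented_piM.
Qed.
End Presented.

Section FreeGroup.
Context (X : choiceType).

(** [(x, false)] is the letter [x] and [(x, true)] its formal inverse. *)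
Definition free_pres : group_pres :=
  @GroupPres (X * bool)%type (fun a => (a.1, ~~ a.2)) (fun _ _ => False).

Definition free_group : Type := presented free_pres.
HB.instance Definition _ := Group.on free_group.

Definition free_gen (x : X) : free_group := letterg (P := free_pres) (x, false).

Definition free_lift (H : groupType) (f : X -> H) : free_group -> H :=
  presented_lift (P := free_pres) (fun a => if a.2 then (f a.1)^-1 else f a.1).

Section Lift.
Context (H : groupType) (f : X -> H).

Fact free_lift_letterV (a : free_pres) :
  (if (linv a).2 then (f (linv a).1)^-1 else f (linv a).1) =
  (if a.2 then (f a.1)^-1 else f a.1)^-1.
Proof. by case: a => x [] //=; rewrite invgK. Qed.

Lemma free_lift_gen x : free_lift f (free_gen x) = f x.
Proof. by rewrite /free_lift presented_liftE //; exact: free_lift_letterV. Qed.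

Fact free_lift_monoid_morphism : monoid_morphism (free_lift f).
Proof. by apply: presented_lift_monoid_morphism => //; exact: free_lift_letterV. Qed.
HB.instance Definition _ :=
  isUMagmaMorphism.Build free_group H (free_lift f) free_lift_monoid_morphism.
End Lift.

Lemma free_group_ind (S : free_group -> Prop) :
  S 1 -> (forall x y, S y -> S (free_gen x * y)) ->
  (forall x y, S y -> S ((free_gen x)^-1 * y)) -> forall y, S y.
Proof.
move=> S1 SM SV; apply: presented_ind => // -[x []] y Sy; last exact: SM.
by have := SV x _ Sy; rewrite -(@lettergV free_pres).
Qed.
End FreeGroup.

Section FreeProduct.
Context (A B : groupType).

Inductive free_product_rule : seq (A + B) -> seq (A + B) -> Prop :=
| free_product_rulel a a' : free_product_rule [:: inl a; inl a'] [:: inl (a * a')]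
| free_product_ruler b b' : free_product_rule [:: inr b; inr b'] [:: inr (b * b')].

Definition free_product_pres : group_pres :=
  @GroupPres (A + B)%type
    (fun c => match c with inl a => inl a^-1 | inr b => inr b^-1 end)
    free_product_rule.

Definition free_product : Type := presented free_product_pres.
HB.instance Definition _ := Group.on free_product.

Definition free_inl (a : A) : free_product :=
  letterg (P := free_product_pres) (inl a).
Definition free_inr (b : B) : free_product :=
  letterg (P := free_product_pres) (inr b).

Fact free_inl_morphism : {morph free_inl : x y / x / y}.
Proof.
move=> x y; rewrite /free_inl -(@lettergV free_product_pres (inl y)) /=.
rewrite [RHS]presented_piM; apply/presentedP/weq_sym/weq_rule.
exact: free_product_rulel.
Qed.
HB.instance Definition _ :=
  isGroupMorphism.Build A free_product free_inl free_inl_morphism.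

Fact free_inr_morphism : {morph free_inr : x y / x / y}.
Proof.
move=> x y; rewrite /free_inr -(@lettergV free_product_pres (inr y)) /=.
rewrite [RHS]presented_piM; apply/presentedP/weq_sym/weq_rule.
exact: free_product_ruler.
Qed.
HB.instance Definition _ :=
  isGroupMorphism.Build B free_product free_inr free_inr_morphism.

Definition free_product_lift (H : groupType) (f : A -> H) (g : B -> H) :
    free_product -> H :=
  presented_lift (P := free_product_pres)
    (fun c => match c with inl a => f a | inr b => g b end).

Section Lift.
Context (H : groupType) (f : {ghom A -> H}) (g : {ghom B -> H}).
Local Notation fg :=
  (fun c : A + B => match c with inl a => f a | inr b => g b end).

Fact free_product_lift_letterV (c : free_product_pres) :
  fg (linv c) = (fg c)^-1.
Proof. by case: c => c /=; rewrite gmulfV. Qed.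

Fact free_product_lift_rule (u v : seq free_product_pres) : rule u v ->
  \prod_(c <- u) fg c = \prod_(c <- v) fg c.
Proof.
by case=> c c'; rewrite !big_cons !big_nil !mulg1 gmulfM.
Qed.

Lemma free_product_lift_inl a : free_product_lift f g (free_inl a) = f a.
Proof.
by rewrite /free_product_lift presented_liftE //;
  [exact: free_product_lift_letterV|exact: free_product_lift_rule].
Qed.

Lemma free_product_lift_inr b : free_product_lift f g (free_inr b) = g b.
Proof.
by rewrite /free_product_lift presented_liftE //;
  [exact: free_product_lift_letterV|exact: free_product_lift_rule].
Qed.

Fact free_product_lift_monoid_morphism :
  monoid_morphism (free_product_lift f g).
Proof.
by apply: presented_lift_monoid_morphism;
  [exact: free_product_lift_letterV|exact: free_product_lift_rule].
Qed.
HB.instance Definition _ := isUMagmaMorphism.Build free_product H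
  (free_product_lift f g) free_product_lift_monoid_morphism.
End Lift.

Lemma free_product_ind (S : free_product -> Prop) :
  S 1 -> (forall a y, S y -> S (free_inl a * y)) ->
  (forall b y, S y -> S (free_inr b * y)) -> forall y, S y.
Proof.
by move=> S1 Sl Sr; apply: presented_ind => // -[c|c] y; [exact: Sl|exact: Sr].
Qed.
End FreeProduct.

Record open_subgroup (G : topologicalGroupType) := OpenSubgroup {
  open_subgroup_subgroup :> subgroup G ;
  open_subgroup_open : open (subgroup_set open_subgroup_subgroup)
}.

Record open_mono (U : topologicalGroupType) (O : open_subgroup U) := OpenMono {
  open_mono_fun :> {ghom subgroup_type O -> U} ;
  open_mono_continuous : continuous open_mono_fun ;
  open_mono_inj : injective open_mono_fun ;
  open_mono_open : forall V : set (subgroup_type O),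
    open V -> open (open_mono_fun @` V)
}.

Section HX.
Context (U : topologicalGroupType) (O : open_subgroup U) (phi : open_mono O).
Context (X : finType).

Local Notation inU := (@free_inl U (free_group X)).
Local Notation inF := (@free_inr U (free_group X)).

Definition HX_relators : set (free_product U (free_group X)) :=
  [set w | exists (t : X) (o : subgroup_type O),
     w = inF (free_gen t) * inU (val o) * (inF (free_gen t))^-1
         * (inU (phi o))^-1].

(** For [X] empty this is [U], see [HX_base_bij]. *)
Definition HX : Type := quotg (normal_closure HX_relators).
HB.instance Definition _ := Group.on HX.

Definition HX_pi : free_product U (free_group X) -> HX :=
  quotg_pi (normal_closure HX_relators).
HB.instance Definition _ := UMagmaMorphism.on HX_pi.

Let inF1 : inF 1 = 1. Proof. exact: gmulf1. Qed.
Let inFM : {morph inF : x y / x * y}. Proof. exact: gmulfM. Qed.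
Let inFV : {morph inF : x / x^-1}. Proof. exact: gmulfV. Qed.
Let HX_pi1 : HX_pi 1 = 1. Proof. exact: gmulf1. Qed.
Let HX_piM : {morph HX_pi : x y / x * y}. Proof. exact: gmulfM. Qed.
Let HX_piV : {morph HX_pi : x / x^-1}. Proof. exact: gmulfV. Qed.

Definition HX_base : U -> HX := HX_pi \o inU.
HB.instance Definition _ := UMagmaMorphism.on HX_base.

Let HX_baseM : {morph HX_base : x y / x * y}. Proof. exact: gmulfM. Qed.

Definition HX_free : free_group X -> HX := HX_pi \o inF.
HB.instance Definition _ := UMagmaMorphism.on HX_free.

Definition HX_gen (t : X) : HX := HX_free (free_gen t).

Lemma HX_rel t (o : subgroup_type O) :
  HX_gen t * HX_base (val o) * (HX_gen t)^-1 = HX_base (phi o).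
Proof.
apply/divg1_eq; rewrite /HX_gen /HX_free /HX_base /=.
rewrite -!HX_piV -!HX_piM; apply/quotg_pi_eq1.
by apply: sub_normal_closure; exists t, o.
Qed.

Lemma HX_ind (S : HX -> Prop) :
  S 1 -> (forall u h, S h -> S (HX_base u * h)) ->
  (forall t h, S h -> S (HX_gen t * h)) ->
  (forall t h, S h -> S ((HX_gen t)^-1 * h)) -> forall h, S h.
Proof.
move=> S1 SU SX SV h; have [w ->] : exists w, h = HX_pi w := quotg_pi_surj h.
elim/free_product_ind: w => [|u w Sw|f w].
- by rewrite HX_pi1.
- by rewrite HX_piM; exact: SU.
- elim/free_group_ind: f w => [|t f IH|t f IH] w Sw.
  + by rewrite inF1 mul1g.
  + by rewrite inFM -mulgA HX_piM; apply: SX; exact: IH.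
  + by rewrite inFM -mulgA HX_piM inFV HX_piV;
      apply: SV; exact: IH.
Qed.

(** The topology of [HX]: [W] is open when all the sets [h^-1 W], restricted
    to [U], are open.  It is the unique group topology for which [HX_base] is
    continuous and open: see [HX_base_continuous], [HX_base_open],
    [HX_topology_unique]. *)
Definition HX_open : set (set HX) :=
  [set W | forall h, open [set u | W (h * HX_base u)]].

Fact HX_openT : HX_open setT.
Proof. by move=> h; exact: openT. Qed.
Fact HX_openI : setI_closed HX_open.
Proof. by move=> V W oV oW h; apply: openI; [exact: oV|exact: oW]. Qed.
Fact HX_open_bigU (I : Type) (F : I -> set HX) :
  (forall i, HX_open (F i)) -> HX_open (\bigcup_i F i).
Proof.
move=> oF h.
have -> : [set u | (\bigcup_i F i) (h * HX_base u)] =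
          \bigcup_i [set u | F i (h * HX_base u)] by [].
by apply: bigcup_open => i _; exact: oF.
Qed.

HB.instance Definition _ := isOpenTopological.Build HX
  HX_openT HX_openI HX_open_bigU.

Lemma HX_nbhsP (h : HX) (W : set HX) :
  nbhs h W <-> nbhs (1 : U) [set u | W (h * HX_base u)].
Proof.
split.
  rewrite nbhsE => -[V [oV Vh] VW].
  apply: (@filterS _ _ _ [set u | V (h * HX_base u)]); first by move=> u /VW.
  by apply: open_nbhs_nbhs; split; [exact: oV|rewrite /= gmulf1 mulg1].
rewrite nbhsE => -[V [oV V1] VW].
rewrite nbhsE; exists [set h * HX_base v | v in V]; last first.
  by move=> _ [v Vv <-]; exact: VW.
split; last by exists 1 => //; rewrite gmulf1 mulg1.
move=> g; rewrite openE => u /= [v Vv hv].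
have Vu : nbhs (v * u^-1 * u) V by rewrite mulgVK; exact: open_nbhs_nbhs.
have := nbhs_mulgl Vu; apply: filterS => u' /= Vu'.
exists (v * u^-1 * u') => //.
by rewrite gmulfM mulgA gmulfM mulgA hv -[_ * _ * HX_base u^-1]mulgA -gmulfM
  mulgV gmulf1 mulg1.
Qed.

Lemma HX_conj (h : HX) (V : set U) : nbhs (1 : U) V ->
  exists2 V' : set U, nbhs (1 : U) V' &
    forall u, V' u -> exists2 v, V v & HX_base u ^ h = HX_base v.
Proof.
elim/HX_ind: h V => [|a h IH|t h IH|t h IH] V nV.
- by exists V => // u Vu; exists u => //; rewrite conjg1.
- have [V' nV' V'P] := IH V nV.
  have n1 : nbhs (a^-1 * 1 * a) V' by rewrite mulg1 mulVg.
  have n2 := @mulgr_continuous U a (a^-1 * 1) _ n1.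
  exists [set u | V' (u ^ a)].
    by have := nbhs_mulgl n2; apply: filterS => u /=; rewrite /conjg mulgA.
  by move=> u /V'P[v Vv vE]; exists v => //; rewrite conjgM -gmulfJ.
- have [V' nV' V'P] := IH V nV.
  have : nbhs (1 : U) (phi @` ((\val : subgroup_type O -> U) @^-1` V')).
    move: nV'; rewrite nbhsE => -[B [oB B1] BV'].
    exists (phi @` ((\val : subgroup_type O -> U) @^-1` B)).
      split; first by apply: open_mono_open; exists B.
      by exists 1; rewrite ?gmulf1 //= val1.
    by move=> _ [o Bo <-]; exists o => //; exact: BV'.
  move=> nphi; exists (phi @` ((\val : subgroup_type O -> U) @^-1` V')) => //.
  move=> _ [o /V'P[v Vv vE] <-]; exists v => //.
  by rewrite conjgM -(HX_rel t) -vE /conjg mulgVK mulKg.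
- have [V' nV' V'P] := IH V nV.
  have : nbhs (1 : U)
      ((\val : subgroup_type O -> U) @` (phi @^-1` V')).
    have nphi : nbhs (1 : subgroup_type O) (phi @^-1` V').
      by apply: open_mono_continuous; rewrite gmulf1.
    move: nphi => [_ [[B oB <-]] B1 BV'].
    rewrite nbhsE; exists (B `&` subgroup_set O).
      split; first by apply: openI => //; exact: open_subgroup_open.
      by split; [exact: B1|exact: subgroup1].
    move=> u [Bu Ou]; exists (exist _ u (mem_set Ou) : subgroup_type O) => //.
    exact: BV'.
  move=> nphi; exists ((\val : subgroup_type O -> U) @` (phi @^-1` V')) => //.
  move=> _ [o /V'P[v Vv vE] <-]; exists v => //.
  by rewrite conjgM -vE -(HX_rel t) /conjg invgK !mulgA.
Qed.

Fact HX_mulg_continuous : continuous (fun xy : HX * HX => xy.1 * xy.2).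
Proof.
move=> [g h] W /HX_nbhsP /= nW.
have n11 : nbhs (1 * 1 : U) [set u | W (g * h * HX_base u)] by rewrite mulg1.
have [[A B] /= [nA nB] AB] := @mulg_continuous U (1, 1) _ n11.
have [A' nA' A'P] := HX_conj h nA.
exists ([set g * HX_base u | u in A'], [set h * HX_base u | u in B]).
  split=> /=; apply/HX_nbhsP; [have := nA'|have := nB];
    by apply: filterS => u ?; exists u.
move=> [_ _] /= [[u /A'P[v Av vE] <-] [w Bw <-]].
have -> : g * HX_base u * (h * HX_base w) = g * h * HX_base (v * w).
  by rewrite HX_baseM -vE /conjg !mulgA mulgK.
exact: (AB (v, w)).
Qed.

Fact HX_invg_continuous : continuous (fun x : HX => x^-1).
Proof.
move=> g W /HX_nbhsP /= nW; apply/HX_nbhsP.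
have [A nA AP] := HX_conj g^-1 nW.
have n1 : nbhs ((1 : U)^-1) A by rewrite invg1.
have : nbhs (1 : U) [set u | A u^-1] := @invg_continuous U 1 _ n1.
apply: filterS => u /= /AP[v /= Wv].
rewrite gmulfV => vE.
suff -> : (g * HX_base u)^-1 = g^-1 * HX_base v by [].
by rewrite -vE invgM /conjg invgK !mulgA mulVg mul1g.
Qed.

HB.instance Definition _ := isTopologicalGroup.Build HX
  HX_mulg_continuous HX_invg_continuous.

Lemma HX_base_continuous : continuous HX_base.
Proof.
move=> u W /HX_nbhsP nW.
have n1 : nbhs (u^-1 * u) [set v | W (HX_base u * HX_base v)] by rewrite mulVg.
have := nbhs_mulgl n1; apply: filterS => v /=.
by rewrite -HX_baseM mulVKg.
Qed.

Lemma HX_base_open (V : set U) : open V -> open (HX_base @` V).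
Proof.
move=> oV; rewrite openE => _ [u Vu <-]; apply/HX_nbhsP.
have n1 : nbhs (u * 1) V by rewrite mulg1; exact: open_nbhs_nbhs.
have := nbhs_mulgl n1; apply: filterS => v /= Vv.
by exists (u * v) => //; rewrite HX_baseM.
Qed.

(** Any other group topology on [HX], transported along a bijective morphism
    [f], for which the canonical map from [U] is continuous and open, has the
    same open sets. *)
Lemma HX_topology_unique (T : topologicalGroupType) (f : {ghom HX -> T}) :
  bijective f -> continuous (f \o HX_base) ->
  (forall V : set U, open V -> open ((f \o HX_base) @` V)) ->
  forall W : set HX, open W <-> open (f @` W).
Proof.
move=> /[dup] bf [g fK gK] fc fo W.
have nP (h : HX) (W' : set HX) : nbhs h W' <-> nbhs (f h) (f @` W').
  split.
    move=> /HX_nbhsP; rewrite nbhsE => -[V [oV V1] VW].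
    have n1 : nbhs ((f h)^-1 * f h) ((f \o HX_base) @` V).
      rewrite mulVg; apply: open_nbhs_nbhs; split; first exact: fo.
      by exists 1 => //=; rewrite !gmulf1.
    have := nbhs_mulgl n1; apply: filterS => y /= [v Vv vE].
    exists (h * HX_base v); first exact: VW.
    by rewrite gmulfM vE mulVKg.
  move=> nW; apply/HX_nbhsP.
  have n1 : nbhs (f h * (f \o HX_base) 1) (f @` W') by rewrite !gmulf1 mulg1.
  have : nbhs (1 : U) [set u | (f @` W') (f h * f (HX_base u))] :=
    fc _ _ (nbhs_mulgl n1).
  apply: filterS => u /= [x Wx].
  by rewrite -gmulfM => /(can_inj fK) <-.
rewrite !openE; split=> oW.
  by move=> _ [x Wx <-]; apply/nP/oW.
by move=> x Wx; apply/nP; apply: oW; exists x.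
Qed.

Lemma HX_base_bij : #|X| = 0 -> bijective HX_base.
Proof.
move=> X0; have noX (t : X) : False by have := fintype0 t X0.
have rel1 w : HX_relators w ->
    free_product_lift idfun (one_fun U : free_group X -> U) w = 1.
  by move=> [t]; have := noX t.
pose r := quotg_lift (N := normal_closure HX_relators)
  (free_product_lift idfun (one_fun U : free_group X -> U)).
have rK : cancel HX_base r.
  move=> u; rewrite /r quotg_liftE; last exact: normal_closure_ker rel1.
  exact: (free_product_lift_inl (idfun : {ghom U -> U})
    (one_fun U : {ghom free_group X -> U}) u).
exists r => // h; suff [u ->] : exists u, h = HX_base u by rewrite rK.
elim/HX_ind: h => [|u h [v ->]|t|t]; [|by exists (u * v); rewrite HX_baseM| |].
- by exists 1; rewrite gmulf1.
- by have := noX t.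
- by have := noX t.
Qed.

Definition free_product_to_free : free_product U (free_group X) -> free_group X :=
  free_product_lift (one_fun (free_group X) : U -> free_group X) idfun.
HB.instance Definition _ := UMagmaMorphism.on free_product_to_free.

Lemma free_product_to_free_inl u : free_product_to_free (inU u) = 1.
Proof.
exact: (free_product_lift_inl (one_fun (free_group X) : {ghom U -> free_group X})
  (idfun : {ghom free_group X -> free_group X})).
Qed.

Lemma free_product_to_free_inr w : free_product_to_free (inF w) = w.
Proof.
exact: (free_product_lift_inr (one_fun (free_group X) : {ghom U -> free_group X})
  (idfun : {ghom free_group X -> free_group X})).
Qed.

Fact free_product_to_free_ker w :
  subgroup_set (normal_closure HX_relators) w -> free_product_to_free w = 1.
Proof.
apply: normal_closure_ker => _ [t [o ->]].
have kM : {morph free_product_to_free : x y / x * y} by exact: gmulfM.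
have kV : {morph free_product_to_free : x / x^-1} by exact: gmulfV.
rewrite -[LHS]/(free_product_to_free _).
by rewrite !(kM, kV) !free_product_to_free_inl invg1 !mulg1 mulgV.
Qed.

(** Characterised by [HX_to_free_base] and [HX_to_free_gen]. *)
Definition HX_to_free : HX -> free_group X :=
  quotg_lift (N := normal_closure HX_relators) free_product_to_free.
HB.instance Definition _ := isGroupMorphism.Build HX (free_group X) HX_to_free
  (quotg_lift_morphism free_product_to_free_ker).

Lemma HX_to_free_base u : HX_to_free (HX_base u) = 1.
Proof.
rewrite /HX_to_free quotg_liftE; last exact: free_product_to_free_ker.
exact: free_product_to_free_inl.
Qed.

Lemma HX_to_free_free w : HX_to_free (HX_free w) = w.
Proof.
rewrite /HX_to_free quotg_liftE; last exact: free_product_to_free_ker.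
exact: free_product_to_free_inr.
Qed.

Lemma HX_to_free_gen t : HX_to_free (HX_gen t) = free_gen t.
Proof. exact: HX_to_free_free. Qed.
End HX.

Arguments HX_free {U O} phi {X}.
Arguments HX_gen {U O} phi {X}.

Section GPhi.
Context (U : topologicalGroupType) (O : open_subgroup U) (phi : open_mono O).
Context (X : finType) (R : set (free_group X)).

Definition pres_group : Type := discrete_topology (quotg (normal_closure R)).
HB.instance Definition _ := TopologicalGroup.on pres_group.

Definition pres_group_pi : free_group X -> pres_group :=
  quotg_pi (normal_closure R).
HB.instance Definition _ := UMagmaMorphism.on pres_group_pi.

Definition GPhi : Type := quotg (normal_closure (HX_free phi @` R)).
HB.instance Definition _ := TopologicalGroup.on GPhi.

Definition GPhi_pi : HX phi X -> GPhi :=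
  quotg_pi (normal_closure (HX_free phi @` R)).
HB.instance Definition _ := UMagmaMorphism.on GPhi_pi.

Definition GPhi_base : U -> GPhi := GPhi_pi \o HX_base phi X.
HB.instance Definition _ := UMagmaMorphism.on GPhi_base.

Definition generalisable : Prop := injective GPhi_base.

Definition GPhi_kernel : normal_subgroup GPhi :=
  normal_closure (range GPhi_base).

Definition GPhi_incl : subgroup_type GPhi_kernel -> GPhi := \val.
HB.instance Definition _ := UMagmaMorphism.on GPhi_incl.

Fact GPhi_to_pres_ker h :
  subgroup_set (normal_closure (HX_free phi @` R)) h ->
  (pres_group_pi \o @HX_to_free _ _ phi X) h = 1.
Proof.
apply: normal_closure_ker => _ [w Rw <-] /=; rewrite HX_to_free_free.
exact/quotg_pi_eq1/sub_normal_closure.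
Qed.

(** The epimorphism [p] induced by [HX_to_free], see [GPhi_to_presE]. *)
Definition GPhi_to_pres : GPhi -> pres_group :=
  quotg_lift (N := normal_closure (HX_free phi @` R))
    (pres_group_pi \o @HX_to_free _ _ phi X).
HB.instance Definition _ :=
  isGroupMorphism.Build GPhi pres_group GPhi_to_pres
    (quotg_lift_morphism GPhi_to_pres_ker).

Lemma GPhi_to_presE h :
  GPhi_to_pres (GPhi_pi h) = pres_group_pi (HX_to_free h).
Proof. by rewrite /GPhi_to_pres quotg_liftE //; exact: GPhi_to_pres_ker. Qed.

Lemma GPhi_base_continuous : continuous GPhi_base.
Proof.
move=> u; apply: continuous_comp; first exact: HX_base_continuous.
exact: quotg_pi_continuous.
Qed.

Lemma GPhi_base_open (V : set U) : open V -> open (GPhi_base @` V).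
Proof.
move=> oV; rewrite openE => _ [u Vu <-].
rewrite -[GPhi_base @` V]/((GPhi_pi \o HX_base phi X) @` V) -image_comp.
apply: quotg_pi_nbhs; apply: open_nbhs_nbhs; split; last by exists u.
exact: HX_base_open.
Qed.
End GPhi.

Arguments pres_group {X} R.
Arguments GPhi {U O} phi {X} R.
Arguments GPhi_pi {U O} phi {X} R _.
Arguments GPhi_base {U O} phi {X} R _.
Arguments GPhi_kernel {U O} phi {X} R.
Arguments GPhi_incl {U O} phi {X} R _.
Arguments GPhi_to_pres {U O} phi {X} R _.
Arguments generalisable {U O} phi {X} R.

Lemma hausdorff_open_mono (U G : topologicalGroupType) (f : {ghom U -> G}) :
  injective f -> (forall V : set U, open V -> open (f @` V)) ->
  hausdorff_space U -> hausdorff_space G.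
Proof.
move=> fi fo hU p q pq.
have tr (z : G) (u : U) (V : set U) : nbhs u V ->
    nbhs (z * f u) [set z * f v | v in V].
  rewrite nbhsE => -[B [oB Bu] BV].
  have n1 : nbhs (z^-1 * (z * f u)) (f @` B).
    by rewrite mulKg; apply: open_nbhs_nbhs; split; [exact: fo|exists u].
  have := nbhs_mulgl n1; apply: filterS => t /= [v Bv vE].
  by exists v; [exact: BV|rewrite vE mulVKg].
have tr1 (z : G) (V : set U) : nbhs (1 : U) V -> nbhs z [set z * f v | v in V].
  by move=> /(tr z); rewrite gmulf1 mulg1.
have [_ [[u _ <-] [v _ vE]]] := pq _ _ (tr1 p _ filterT) (tr1 q _ filterT).
have qE : q = p * f (u * v^-1).
  by rewrite gmulfM gmulfV mulgA -vE mulgK.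
suff -> : q = p * f 1 by rewrite gmulf1 mulg1.
rewrite qE; congr (p * f _); apply/esym/hU => A B nA nB.
have := pq _ _ (tr1 p _ nA); rewrite qE => /(_ _ (tr p _ _ nB)).
move=> [_ [[a Aa <-] [b Bb /mulgI/fi ba]]]; exists a; split => //.
by rewrite -ba.
Qed.

Lemma GPhi_hausdorff (U : topologicalGroupType) (O : open_subgroup U)
    (phi : open_mono O) (X : finType) (R : set (free_group X)) :
  hausdorff_space U -> generalisable phi R -> hausdorff_space (GPhi phi R).
Proof.
by move=> hU gR; apply: (hausdorff_open_mono gR) => //; exact: GPhi_base_open.
Qed.

Definition homeomorphism (S T : topologicalType) (f : S -> T) : Prop :=
  exists g : T -> S, [/\ continuous f, continuous g, cancel f g & cancel g f].

Section TopAut.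
Context (N : topologicalGroupType).

Definition is_topaut (f : N -> N) : Prop :=
  {morph f : x y / x * y} /\ homeomorphism f.

Definition topAut : Type := set_type is_topaut.
HB.instance Definition _ := SubChoice.on topAut.

Lemma topAutP (a : topAut) : is_topaut (\val a).
Proof. exact: set_valP. Qed.

Definition MkTopAut f (fP : is_topaut f) : topAut := exist _ f (mem_set fP).

Fact topAut_one_subproof : is_topaut idfun.
Proof. by split=> //; exists idfun; split=> // x; exact: cvg_id. Qed.
Fact topAut_mul_subproof (a b : topAut) : is_topaut (\val a \o \val b).
Proof.
have [[aM [a' [ac a'c aK a'K]]] [bM [b' [bc b'c bK b'K]]]] :=
  (topAutP a, topAutP b).
split=> [x y|]; first by rewrite /= bM aM.
exists (b' \o a'); split.
- by move=> x; apply: continuous_comp; [exact: bc|exact: ac].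
- by move=> x; apply: continuous_comp; [exact: a'c|exact: b'c].
- exact: can_comp.
- exact: can_comp.
Qed.
Fact topAut_inv_subproof (a : topAut) :
  exists b : topAut, cancel (\val a) (\val b) /\ cancel (\val b) (\val a).
Proof.
have [aM [a' [ac a'c aK a'K]]] := topAutP a.
have a'P : is_topaut a'.
  split; last by exists (\val a).
  by move=> x y; rewrite -{1}(a'K x) -{1}(a'K y) -aM aK.
by exists (MkTopAut a'P).
Qed.

Definition topAut_one : topAut := MkTopAut topAut_one_subproof.
Definition topAut_mul (a b : topAut) : topAut :=
  MkTopAut (topAut_mul_subproof a b).
Definition topAut_inv (a : topAut) : topAut :=
  projT1 (cid (topAut_inv_subproof a)).

Fact topAut_mulA : associative topAut_mul.
Proof. by move=> a b c; apply: val_inj. Qed.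
Fact topAut_mul1 : left_id topAut_one topAut_mul.
Proof. by move=> a; apply: val_inj. Qed.
Fact topAut_1mul : right_id topAut_one topAut_mul.
Proof. by move=> a; apply: val_inj. Qed.
Fact topAut_mulV : left_inverse topAut_one topAut_inv topAut_mul.
Proof.
move=> a; apply: val_inj; apply/funext => x /=.
by rewrite /topAut_inv; case: cid => b /= [ab _]; exact: ab.
Qed.
Fact topAut_Vmul : right_inverse topAut_one topAut_inv topAut_mul.
Proof.
move=> a; apply: val_inj; apply/funext => x /=.
by rewrite /topAut_inv; case: cid => b /= [_ ba]; exact: ba.
Qed.

HB.instance Definition _ := isGroup.Build topAut
  topAut_mulA topAut_mul1 topAut_1mul topAut_mulV topAut_Vmul.

Lemma topAutM (a b : topAut) x : \val (a * b) x = \val a (\val b x).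
Proof. by []. Qed.
End TopAut.

Definition semidirect (N G : topologicalGroupType)
    (Phi : {ghom G -> topAut N}) : Type := (N * G)%type.

Section Semidirect.
Context (N G : topologicalGroupType) (Phi : {ghom G -> topAut N}).
Local Notation semidirect := (semidirect Phi).

HB.instance Definition _ := Topological.copy semidirect (N * G)%type.

Definition semidirect_one : semidirect := (1, 1).
Definition semidirect_mul (x y : semidirect) : semidirect :=
  (x.1 * \val (Phi x.2) y.1, x.2 * y.2).
Definition semidirect_inv (x : semidirect) : semidirect :=
  (\val (Phi x.2^-1) x.1^-1, x.2^-1).

Let PhiM g n n' : \val (Phi g) (n * n') = \val (Phi g) n * \val (Phi g) n'.
Proof. exact: (topAutP (Phi g)).1. Qed.
Let Phi_1 g : \val (Phi g) 1 = 1.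
Proof. by apply: (@mulgI _ (\val (Phi g) 1)); rewrite -PhiM !mulg1. Qed.
Let Phi1 n : \val (Phi 1) n = n.
Proof. by rewrite gmulf1. Qed.
Let Phi_mul g h n : \val (Phi (g * h)) n = \val (Phi g) (\val (Phi h) n).
Proof. by rewrite gmulfM. Qed.

Fact semidirect_mulA : associative semidirect_mul.
Proof.
move=> [n g] [m h] [l k]; congr (_, _); rewrite /= ?mulgA //.
by rewrite PhiM Phi_mul mulgA.
Qed.
Fact semidirect_mul1 : left_id semidirect_one semidirect_mul.
Proof. by move=> [n g]; congr (_, _); rewrite /= ?Phi1 mul1g. Qed.
Fact semidirect_1mul : right_id semidirect_one semidirect_mul.
Proof. by move=> [n g]; congr (_, _); rewrite /= ?Phi_1 mulg1. Qed.
Fact semidirect_mulV : left_inverse semidirect_one semidirect_inv semidirect_mul.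
Proof.
move=> [n g]; congr (_, _); rewrite /= ?mulVg //.
by rewrite -PhiM mulVg Phi_1.
Qed.
Fact semidirect_Vmul : right_inverse semidirect_one semidirect_inv semidirect_mul.
Proof.
move=> [n g]; congr (_, _); rewrite /= ?mulgV //.
by rewrite -Phi_mul mulgV Phi1 mulgV.
Qed.

HB.instance Definition _ := isGroup.Build semidirect
  semidirect_mulA semidirect_mul1 semidirect_1mul semidirect_mulV
  semidirect_Vmul.
End Semidirect.

(** [1 -> A -> B -> C -> 1] is exact as a sequence of topological groups: it is
    exact, [i] is a homeomorphism onto its image and [p] is a quotient map. *)
Definition topological_short_exact (A B C : topologicalGroupType)
    (i : {ghom A -> B}) (p : {ghom B -> C}) : Prop :=
  [/\ injective i, range i = p @^-1` [set 1] & range p = setT] /\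
  [/\ continuous i,
      forall V : set A, open V -> exists2 W, open W & V = i @^-1` W,
      continuous p & forall V : set B, open V -> open (p @` V)].

Definition splitting (B C : topologicalGroupType) (p : {ghom B -> C})
    (s : {ghom C -> B}) : Prop :=
  continuous s /\ cancel s p.

(* Main.v *)
(** The words in [X] give a homomorphism [F(X) -> G_phi] killing [R], hence a
    section [s : G -> G_phi] of [p], continuous because [G] is discrete.  Modulo
    [<<U>>] the maps [id] and [s \o p] agree on [U] and on [X], hence everywhere,
    so [ker p = <<U>>].  A continuous section of a continuous homomorphism [p]
    then makes [b |-> (b s(p b)^-1, p b)] a topological isomorphism from [G_phi]
    to [ker p ><| G]. *)
From HB Require Import structures.
Require Import Defs.
From mathcomp Require Import all_boot all_classical.
From mathcomp Require Import topology.

Set Implicit Arguments.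
Unset Strict Implicit.
Unset Printing Implicit Defensive.

Local Open Scope group_scope.
Local Open Scope classical_set_scope.

Lemma pair_continuous (S T T' : topologicalType) (f : S -> T) (g : S -> T') :
  continuous f -> continuous g -> continuous (fun x => (f x, g x)).
Proof. by move=> fc gc x; apply: cvg_pair; [exact: fc|exact: gc]. Qed.

Section ContinuousGroupOperations.
Context (T : topologicalType) (G : topologicalGroupType) (f h : T -> G).

Lemma mulg_fun_continuous :
  continuous f -> continuous h -> continuous (fun t => f t * h t).
Proof. by move=> fc hc t; apply: cvg_mulg; [exact: fc|exact: hc]. Qed.

Lemma invg_fun_continuous : continuous f -> continuous (fun t => (f t)^-1).
Proof.
move=> fc t; apply: continuous_comp; first exact: fc.
exact: invg_continuous.
Qed.
End ContinuousGroupOperations.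

(** * Conjugation action on a normal subgroup *)

Section NormalConjugation.
Context (B : topologicalGroupType) (N : normal_subgroup B).
Local Notation T := (subgroup_type N).

Lemma normal_subgroup_lconj (g x : B) : subgroup_set N x ->
  subgroup_set N (g * x * g^-1).
Proof.
(* [x ^ y] is the right conjugate [y^-1 * x * y], hence the exponent [g^-1]. *)
move=> Nx; have := @normal_subgroupJ _ _ _ g^-1 Nx.
by rewrite /conjg invgK mulgA.
Qed.

(** Conjugation from the left makes [g |-> normal_conj g] multiplicative for composition, which is
    the product of [topAut]. *)
Definition normal_conj (g : B) (n : T) : T :=
  exist _ (g * \val n * g^-1) (mem_set (normal_subgroup_lconj g (set_valP n))).

Lemma val_normal_conj (g : B) (n : T) : \val (normal_conj g n) = g * \val n * g^-1.
Proof. by []. Qed.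

Lemma normal_conj_continuous (g : B) : continuous (normal_conj g).
Proof.
apply: subgroup_continuousP; apply: mulg_fun_continuous; last exact: cst_continuous.
apply: mulg_fun_continuous; first exact: cst_continuous.
exact: subgroup_val_continuous.
Qed.

Lemma normal_conjA (g h : B) (n : T) :
  normal_conj (g * h) n = normal_conj g (normal_conj h n).
Proof. by apply: val_inj; rewrite !val_normal_conj invgM !mulgA. Qed.

Lemma normal_conj1 (n : T) : normal_conj 1 n = n.
Proof. by apply: val_inj; rewrite val_normal_conj invg1 mul1g mulg1. Qed.

Lemma normal_conj_is_topaut (g : B) : is_topaut (normal_conj g).
Proof.
split=> [x y|].
  by apply: val_inj; rewrite gmulfM !val_normal_conj gmulfM !mulgA mulgVK.
exists (normal_conj g^-1); split; try exact: normal_conj_continuous.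
- by move=> x; rewrite -normal_conjA mulVg normal_conj1.
- by move=> x; rewrite -normal_conjA mulgV normal_conj1.
Qed.

Definition conj_topaut (g : B) : topAut T := MkTopAut (normal_conj_is_topaut g).

Fact conj_topaut_monoid_morphism : monoid_morphism conj_topaut.
Proof.
split=> [|g h]; apply: val_inj; apply/funext => n.
  exact: normal_conj1.
exact: normal_conjA.
Qed.
HB.instance Definition _ := isUMagmaMorphism.Build B (topAut T) conj_topaut
  conj_topaut_monoid_morphism.
End NormalConjugation.

(** * Topological extensions with a continuous section *)

Section SplitExtension.
Context (B C : topologicalGroupType) (N : normal_subgroup B).
Context (p : {ghom B -> C}) (s : {ghom C -> B}).
Hypothesis p_continuous : continuous p.
Hypothesis ps : splitting p s.
Hypothesis kerp : forall b, subgroup_set N b <-> p b = 1.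
Local Notation T := (subgroup_type N).

(** Through every point [b] passes a continuous section of [p], a left translate of [s]; it pulls
    [V] back to a neighbourhood of [p b] contained in the image of [V]. *)
Lemma splitting_open (V : set B) : open V -> open (p @` V).
Proof.
have [sc sK] := ps.
move=> oV; rewrite openE => _ [b Vb <-].
(* The factor [b * (s (p b))^-1] lies in the kernel of [p], so this is again a section, and its
   value at [p b] is [b]. *)
have : continuous (fun c => b * (s (p b))^-1 * s c).
  by apply: mulg_fun_continuous => //; exact: cst_continuous.
move=> /(_ (p b)); rewrite /continuous_at mulgVK => /(_ V (open_nbhs_nbhs (conj oV Vb))).
rewrite nbhs_simpl /=; apply: filterS => c /= Vc; exists (b * (s (p b))^-1 * s c) => //.
by rewrite !gmulfM gmulfV !sK mulgV mul1g.
Qed.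

(** Leaving [i] general lets the result apply to [GPhi_incl], which carries its own morphism
    structure. *)
Lemma splitting_short_exact (i : {ghom T -> B}) : i =1 \val ->
  topological_short_exact i p.
Proof.
move=> /funext iE; split; split; rewrite ?iE //.
- apply/seteqP; split=> [_ [n _ <-]|b /= /kerp Nb].
    exact/kerp/set_valP.
  by exists (exist _ b (mem_set Nb) : T).
- by apply/seteqP; split=> // c _; exists (s c) => //; exact: ps.2.
- exact: subgroup_val_continuous.
- by move=> _ [W oW <-]; exists W.
- exact: splitting_open.
Qed.

Definition split_action : C -> topAut T := conj_topaut N \o s.
HB.instance Definition _ := UMagmaMorphism.on split_action.

Lemma split_kernel_part (b : B) : subgroup_set N (b * (s (p b))^-1).
Proof. by apply/kerp; rewrite gmulfM gmulfV ps.2 mulgV. Qed.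

Definition split_iso (b : B) : semidirect split_action :=
  (exist _ (b * (s (p b))^-1) (mem_set (split_kernel_part b)) : T, p b).

Definition split_iso_inv (x : semidirect split_action) : B := \val x.1 * s x.2.

Fact split_iso_monoid_morphism : monoid_morphism split_iso.
Proof.
have eqE (x y : semidirect split_action) :
  \val x.1 = \val y.1 -> x.2 = y.2 -> x = y.
  by case: x y => [x1 x2] [y1 y2] /= /val_inj -> ->.
split=> [|a b]; apply: eqE => /=.
- by rewrite !gmulf1 invg1 mulg1.
- exact: gmulf1.
(* The twist by [s (p a)] cancels the [(s (p a))^-1] in front of it: [a s(p a)^-1 . s(p a) (b s(p
   b)^-1) s(p a)^-1 = a b s(p(a b))^-1]. *)
- rewrite gmulfM /= -[RHS]/(_ * _) /=.
  by rewrite !gmulfM !invgM !mulgA mulgVK.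
- exact: gmulfM.
Qed.
HB.instance Definition _ := isUMagmaMorphism.Build B (semidirect split_action)
  split_iso split_iso_monoid_morphism.

Lemma split_iso_homeomorphism : homeomorphism split_iso.
Proof.
have [sc sK] := ps.
exists split_iso_inv; split.
(* The target has the product topology and its first factor the subspace topology, so it is enough
   to treat [b * (s (p b))^-1] as a map into [B]. *)
- suff kc : continuous (fun b => (split_iso b).1).
    exact: (pair_continuous kc p_continuous).
  apply: subgroup_continuousP.
  apply: mulg_fun_continuous; first by move=> b; exact: cvg_id.
  apply: invg_fun_continuous => b.
  by apply: continuous_comp; [exact: p_continuous|exact: sc].
- apply: mulg_fun_continuous => x.
  + by apply: continuous_comp; [exact: cvg_fst|exact: subgroup_val_continuous].
  + by apply: continuous_comp; [exact: cvg_snd|exact: sc].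
- by move=> b; rewrite /split_iso_inv /= mulgVK.
- move=> [n c]; rewrite /split_iso_inv /=.
  (* As [p] kills [n], the pair [(n, c)] can be read off from the product [n s(c)]. *)
  have pE : p (\val n * s c) = c.
    by rewrite gmulfM sK (kerp _).1 ?mul1g //; exact: set_valP.
  by congr (_, _) => //; apply: val_inj; rewrite /= pE mulgK.
Qed.
End SplitExtension.

(** [HX] is generated by the images of [U] and [X]. This serves to compare the identity with the
    section after [p], modulo the normal closure of [U]. *)
Lemma HX_hom_ext (U : topologicalGroupType) (O : open_subgroup U)
    (phi : open_mono O) (X : finType) (H : groupType)
    (f g : {ghom HX phi X -> H}) :
  (forall u, f (HX_base phi X u) = g (HX_base phi X u)) ->
  (forall t, f (HX_gen phi t) = g (HX_gen phi t)) -> f =1 g.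
Proof.
move=> fgU fgX h; elim/HX_ind: h => [|u h IH|t h IH|t h IH].
- by rewrite !gmulf1.
- by rewrite !gmulfM fgU IH.
- by rewrite !gmulfM fgX IH.
- by rewrite !gmulfM !gmulfV fgX IH.
Qed.

(** * The section of [p], and the continuity and kernel of [p] *)

Section PresentationSection.
Context (U : topologicalGroupType) (O : open_subgroup U) (phi : open_mono O).
Context (X : finType) (R : set (free_group X)).

Fact pres_section_ker w : subgroup_set (normal_closure R) w ->
  (GPhi_pi phi R \o HX_free phi) w = 1.
Proof.
apply: normal_closure_ker => r Rr.
by apply/quotg_pi_eq1/sub_normal_closure; exists r.
Qed.

Definition pres_section : pres_group R -> GPhi phi R :=
  quotg_lift (N := normal_closure R) (GPhi_pi phi R \o HX_free phi).
HB.instance Definition _ :=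
  isGroupMorphism.Build (pres_group R) (GPhi phi R) pres_section
    (quotg_lift_morphism pres_section_ker).

Lemma pres_sectionE w :
  pres_section (pres_group_pi R w) = GPhi_pi phi R (HX_free phi w).
Proof. by rewrite /pres_section quotg_liftE //; exact: pres_section_ker. Qed.

Lemma GPhi_to_pres_base u : GPhi_to_pres phi R (GPhi_base phi R u) = 1.
Proof. by rewrite GPhi_to_presE HX_to_free_base gmulf1. Qed.

Lemma pres_section_splitting : splitting (GPhi_to_pres phi R) pres_section.
Proof.
split=> [g A /nbhs_singleton Ag|g].
  by rewrite nbhs_simpl /= nbhs_principalE; apply/principal_filterP.
have [w ->] : exists w, g = pres_group_pi R w := quotg_pi_surj g.
by rewrite /= pres_sectionE GPhi_to_presE HX_to_free_free.
Qed.

(** Since [p] kills [U], it is constant on each left coset of [U]; the preimage of any set therefore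
    meets a coset in everything or in nothing. *)
Lemma GPhi_to_pres_continuous : continuous (GPhi_to_pres phi R).
Proof.
apply/continuousP => A _.
(* This is openness of the preimage of [A] with the quotient topology and then [HX_open]
   unfolded. *)
suff oA (h : HX phi X) :
    open [set u | A (GPhi_to_pres phi R (GPhi_pi phi R (h * HX_base phi X u)))].
  exact: oA.
have pE u : GPhi_to_pres phi R (GPhi_pi phi R (h * HX_base phi X u)) =
    GPhi_to_pres phi R (GPhi_pi phi R h).
  by rewrite !gmulfM [X in _ * X]GPhi_to_pres_base mulg1.
have [Ah|nAh] := pselect (A (GPhi_to_pres phi R (GPhi_pi phi R h))).
- rewrite (_ : [set _ | _] = setT); first exact: openT.
  by apply/seteqP; split=> // u _; rewrite /= pE.
- rewrite (_ : [set _ | _] = set0); first exact: open0.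
  by apply/seteqP; split=> // u; rewrite /= pE.
Qed.

Lemma GPhi_kernelP b :
  subgroup_set (GPhi_kernel phi R) b <-> GPhi_to_pres phi R b = 1.
Proof.
split; first by apply: normal_closure_ker => _ [u _ <-]; exact: GPhi_to_pres_base.
pose q := quotg_pi (GPhi_kernel phi R).
have qE : q \o GPhi_pi phi R =1
    q \o (pres_section \o (GPhi_to_pres phi R \o GPhi_pi phi R)).
  apply: HX_hom_ext => [u|t] /=; last first.
    by rewrite GPhi_to_presE HX_to_free_gen pres_sectionE.
  (* On [U] both sides are trivial: [p] kills [u] on the right, and [q] kills it on the left. *)
  rewrite [GPhi_to_pres _ _ _]GPhi_to_pres_base !gmulf1.
  by apply/quotg_pi_eq1/sub_normal_closure; exists u.
have [h ->] : exists h, b = GPhi_pi phi R h := quotg_pi_surj b.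
(* If [p b = 1], then [q b = q (s (p b)) = q 1 = 1]. *)
move=> pb; apply/quotg_pi_eq1.
by apply: etrans (qE h) _; rewrite /= pb !gmulf1.
Qed.
End PresentationSection.

Theorem proposition3p8 (U : topologicalGroupType) (hU : hausdorff_space U)
    (O : open_subgroup U) (phi : open_mono O)
    (X : finType) (R : set (free_group X)) (hR : generalisable phi R) :
  topological_short_exact (GPhi_incl phi R) (GPhi_to_pres phi R) /\
  exists s : {ghom pres_group R -> GPhi phi R},
    splitting (GPhi_to_pres phi R) s /\
    exists Phi : {ghom pres_group R ->
                  topAut (subgroup_type (GPhi_kernel phi R))},
      (forall g n, GPhi_incl phi R (\val (Phi g) n) =
                   s g * GPhi_incl phi R n * (s g)^-1) /\
      exists Psi : {ghom GPhi phi R -> semidirect Phi}, homeomorphism Psi.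
Proof.
have pc := @GPhi_to_pres_continuous _ _ phi _ R.
have ps := pres_section_splitting phi R.
have kerp := @GPhi_kernelP _ _ phi _ R.
split; first exact: (splitting_short_exact pc ps kerp).
exists (pres_section phi (R := R)); split=> //.
(* The conjugation formula for this action holds by computation from [normal_conj]. *)
exists (split_action (GPhi_kernel phi R) (pres_section phi (R := R))); split=> //.
exists (split_iso ps kerp); exact: split_iso_homeomorphism.
Qed.
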